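(* Let $X$ be a finite undirected graph with vertex set $\{1,\dots,n\}$, and let $\mathbf{F}\colon\{0,1\}^n\to\{0,1\}^n$ be the synchronous bi-threshold graph dynamical system map over $X$ with arbitrary integer up-thresholds $(k^\uparrow_v)_v$ and down-thresholds $(k^\downarrow_v)_v$. Then $\mathbf{F}$ only has fixed points and $2$-cycles as limit sets, i.e. every periodic point of $\mathbf{F}$ has period $1$ or $2$.
   Context: Graphs are finite, undirected and simple. Let $K=\{0,1\}$. For a vertex $v$, $N[v]$ denotes the closed neighborhood of $v$ ($v$ together with its neighbors). For $x\in K^n$ put $\sigma(x[v])=|\{u\in N[v] : x_u=1\}|$ (this count includes $v$ itself). The bi-threshold vertex function $f_v$ with up-threshold $k^\uparrow_v$ and down-threshold $k^\downarrow_v$ is: if $x_v=0$, then $f_v=1$ when $\sigma(x[v])\ge k^\uparrow_v$ and $f_v=0$ otherwise; if $x_v=1$, then $f_v=1$ when $\sigma(x[v])\ge k^\downarrow_v$ and $f_v=0$ otherwise. The synchronous map $\mathbf{F}$ updates all coordinates simultaneously: the $v$-th coordinate of $\mathbf{F}(x)$ is $f_v$ evaluated at $x$. A point $x$ is periodic if $\mathbf{F}^p(x)=x$ for some $p\ge1$; the least such $p$ is its period. The limit set of a state is the unique periodic orbit reached from it. *)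

(* Defs.v *)
From HB Require Import structures.
From mathcomp Require Import all_boot all_order all_algebra.
Set Implicit Arguments.
Unset Strict Implicit.
Unset Printing Implicit Defensive.
Import Order.TTheory GRing.Theory Num.Theory.

(* K^n with K = {0,1}; the vertices 1, ..., n are represented by 'I_n. *)
Definition state (n : nat) := {ffun 'I_n -> bool}.

Definition closed_nbhd (n : nat) (e : rel 'I_n) (v : 'I_n) : {set 'I_n} :=
  [set u | (u == v) || e v u].

Definition sigma (n : nat) (e : rel 'I_n) (x : state n) (v : 'I_n) : nat :=
  #|[set u in closed_nbhd e v | x u]|.

Definition bithreshold (n : nat) (e : rel 'I_n) (kup kdown : 'I_n -> int)
    (v : 'I_n) (x : state n) : bool :=
  if x v then (kdown v <= (sigma e x v)%:Z)%R
  else (kup v <= (sigma e x v)%:Z)%R.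

Definition sync_map (n : nat) (e : rel 'I_n) (kup kdown : 'I_n -> int)
    (x : state n) : state n :=
  [ffun v => bithreshold e kup kdown v x].

Definition periodic (T : Type) (F : T -> T) (x : T) : Prop :=
  exists2 p : nat, 0 < p & iter p F x = x.

Definition has_period (T : Type) (F : T -> T) (x : T) (p : nat) : Prop :=
  [/\ 0 < p, iter p F x = x
    & forall q : nat, 0 < q -> iter q F x = x -> p <= q].

(* On a finite state space the periodic points in the forward orbit of x form
   exactly one periodic orbit. *)
Definition limit_set (T : Type) (F : T -> T) (x y : T) : Prop :=
  periodic F y /\ exists m : nat, iter m F x = y.

Definition is_fixed_point (T : Type) (F : T -> T) (L : T -> Prop) : Prop :=
  exists2 y : T, F y = y & forall w : T, L w <-> w = y.

Definition is_two_cycle (T : Type) (F : T -> T) (L : T -> Prop) : Prop :=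
  exists y z : T, [/\ y <> z, F y = z, F z = y
                    & forall w : T, L w <-> w = y \/ w = z].

(* Main.v *)
(** The self-dependence of a bi-threshold rule can be absorbed into a diagonal
    weight: [f_v = 1] iff [sum_u a_vu x_u >= kup_v] with [a] the adjacency
    matrix off the diagonal and [a_vv = kup_v - kdown_v + 1].  Thus [F] is a
    symmetric threshold network, and the Goles-Olivos energy of the pair
    [(x, F x)] strictly increases along the orbit unless [F (F x) = x].
    Hence every periodic point satisfies [F (F x) = x]. *)
Require Import Defs.
From HB Require Import structures.
From mathcomp Require Import all_boot all_order all_algebra.
From mathcomp Require Import zify ring.
Set Implicit Arguments.
Unset Strict Implicit.
Unset Printing Implicit Defensive.
Import Order.TTheory GRing.Theory Num.Theory.

Section ThresholdNetwork.
Local Open Scope ring_scope.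
Variables (T : finType) (a : T -> T -> int) (theta : T -> int).
Hypothesis a_sym : forall u v, a u v = a v u.
Implicit Types x y : {ffun T -> bool}.

Definition threshold_map x : {ffun T -> bool} :=
  [ffun v => theta v <= \sum_u a v u * (x u)%:Z].

(* Doubling and shifting by 1 makes the field odd, hence never zero. *)
Definition local_field x v : int :=
  2 * (\sum_u a v u * (x u)%:Z - theta v) + 1.

(** Expanding the field gives [y v] the linear coefficient [1 - 2 * theta v]; the last summand gives
    [x v] the same one, so that symmetry of [a] makes the whole expression symmetric. *)
Definition energy x y : int :=
  \sum_v ((y v)%:Z * local_field x v + (1 - 2 * theta v) * (x v)%:Z).

Lemma energyC x y : energy x y = energy y x.
Proof.
have energyE x' y' : energy x' y' =
    2 * (\sum_v \sum_u a v u * (x' u)%:Z * (y' v)%:Z)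
    + \sum_v (1 - 2 * theta v) * ((x' v)%:Z + (y' v)%:Z).
  rewrite mulr_sumr -big_split; apply: eq_bigr => v _ /=.
  by rewrite -mulr_suml /local_field; ring.
rewrite !energyE exchange_big /=; congr (2 * _ + _).
  apply: eq_bigr => v _; apply: eq_bigr => u _.
  by rewrite a_sym; ring.
by apply: eq_bigr => v _; rewrite [(x v)%:Z + _]addrC.
Qed.

Lemma energy_threshold_mapB x y :
  energy y (threshold_map y) - energy y x =
  \sum_v ((threshold_map y v)%:Z - (x v)%:Z) * local_field y v.
Proof. by rewrite -sumrB; apply: eq_bigr => v _; ring. Qed.

(** The new value is 1 when the field is at least 1 and 0 when it is at most -1, so a disagreement
    with [x v] contributes the absolute value of a nonzero field. *)
Lemma threshold_map_field_ge0 x y v :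
  0 <= ((threshold_map y v)%:Z - (x v)%:Z) * local_field y v
       ?= iff (threshold_map y v == x v).
Proof.
rewrite ffunE /local_field; set s := \sum_u _.
by case: leP => hs; case: (x v); split; lia.
Qed.

Lemma energy_threshold_map x :
  energy x (threshold_map x) <=
  energy (threshold_map x) (threshold_map (threshold_map x))
  ?= iff (threshold_map (threshold_map x) == x).
Proof.
set y := threshold_map x.
have := leif_sum (fun v (_ : true) => threshold_map_field_ge0 x y v).
(* Symmetry turns [energy y x] into [energy x y], so the sum is the gain from one pair of
   consecutive states to the next. *)
rewrite big1_eq -energy_threshold_mapB [energy y x]energyC => -[ge0 eq0].
split; first by rewrite -subr_ge0.
rewrite eq_sym -subr_eq0 eq_sym eq0.
apply/forall_inP/eqP => [eqxy | -> //].
by apply/ffunP => v; apply/eqP/eqxy.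
Qed.

Lemma threshold_map_periodic x :
  periodic threshold_map x -> threshold_map (threshold_map x) = x.
Proof.
pose E t := energy (iter t threshold_map x) (iter t.+1 threshold_map x).
have E_homo : {homo E : s t / (s <= t)%N >-> s <= t}.
  apply: homo_leq => [// | ? ? ? | t]; first exact: le_trans.
  exact: (energy_threshold_map (iter t threshold_map x)).1.
move=> [[//|p] _ xp].
(* The energy returns to its start after a full period of length at least 1, so monotonicity gives
   [E 1 <= E 0]: the first step is an equality case. *)
have Ep : E p.+1 = E 0 by rewrite /E (iterS p.+1) xp.
apply/eqP; rewrite -(energy_threshold_map x).2 eq_le.
rewrite (energy_threshold_map x).1 /=.
by rewrite -[leRHS]/(E 0) -Ep; apply: (E_homo 1).
Qed.

End ThresholdNetwork.

Definition bithreshold_weight n (e : rel 'I_n) (kup kdown : 'I_n -> int)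
    (v u : 'I_n) : int :=
  (if u == v then kup v - kdown v + 1 else (e v u)%:Z)%R.

Lemma sync_map_threshold n (e : rel 'I_n) (kup kdown : 'I_n -> int) :
  sync_map e kup kdown =1 threshold_map (bithreshold_weight e kup kdown) kup.
Proof.
move=> x; apply/ffunP => v; rewrite !ffunE /bithreshold.
have -> : ((sigma e x v)%:Z =
    (x v)%:Z + \sum_(u | u != v) (e v u)%:Z * (x u)%:Z)%R.
  rewrite /sigma -sum1_card big_mkcond (bigD1 v) //= PoszD.
  congr (_ + _)%R; first by rewrite !inE eqxx; case: (x v).
  rewrite -natz natr_sum; apply: eq_bigr => u /negPf uv.
  by rewrite !inE uv; case: (e v u); case: (x u).
rewrite [in RHS](bigD1 v) //= {1}/bithreshold_weight eqxx.
rewrite [in RHS](eq_bigr (fun u => (e v u)%:Z * (x u)%:Z)%R).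
  (* Here [s] counts the neighbours of [v] in state 1 other than [v]. If [x v] holds,
     [kup v <= kup v - kdown v + 1 + s] reduces to [kdown v <= 1 + s]; otherwise the diagonal term
     vanishes. *)
  by set s : int := (\sum_(_ | _) _)%R; case: (x v) => /=; lia.
by move=> u /negPf uv; rewrite /bithreshold_weight uv.
Qed.

Lemma sync_map_periodic n (e : rel 'I_n) (kup kdown : 'I_n -> int) x :
  symmetric e -> periodic (sync_map e kup kdown) x ->
  sync_map e kup kdown (sync_map e kup kdown x) = x.
Proof.
move=> e_sym [p p_gt0 xp]; rewrite !sync_map_threshold.
apply: threshold_map_periodic => [u v|].
  by rewrite /bithreshold_weight eq_sym e_sym; case: eqP => // ->.
by exists p; rewrite // -(eq_iter (sync_map_threshold e kup kdown)).
Qed.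

Section PeriodAtMostTwo.
Variables (T : finType) (F : T -> T).

Lemma eventually_periodic x : exists m, periodic F (iter m F x).
Proof.
(* Pigeonhole: the iterate at time [order F x] repeats the one at an earlier time [i], and the gap
   is a period. *)
have /trajectP[i lt_i eq_i] := looping_order F x.
exists i; exists (fingraph.order F x - i); first by rewrite subn_gt0.
by rewrite -iterD subnK // ltnW.
Qed.

Hypothesis F2 : forall x, periodic F x -> F (F x) = x.

Lemma iter_involutive_point x k :
  F (F x) = x -> iter k F x = if odd k then F x else x.
Proof. by move=> FFx; elim: k => //= k ->; case: (odd k). Qed.

Lemma limit_set_two_points x :
  exists2 y, F (F y) = y & forall w, limit_set F x w <-> w = y \/ w = F y.
Proof.
have [m per_y] := eventually_periodic x; have FFy := F2 per_y.
exists (iter m F x) => // w; split=> [[per_w [k def_w]]|].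
  (* The time [k] at which [w] is reached may precede [m]. As [F (F w) = w], an even delay of [m.*2]
     leaves [w] unchanged and puts it on the orbit of [iter m F x]. *)
  have <- : iter m.*2 F w = w.
    by rewrite iter_involutive_point ?odd_double //; apply: F2.
  rewrite -def_w -iterD (_ : m.*2 + k = (m + k) + m); last by lia.
  rewrite (iterD (m + k)) iter_involutive_point //.
  by case: odd; [right | left].
case=> ->; split=> //; [by exists m | by exists 2; rewrite //= FFy |].
by exists m.+1.
Qed.

Lemma limit_set_fixed_or_two_cycle x :
  is_fixed_point F (limit_set F x) \/ is_two_cycle F (limit_set F x).
Proof.
have [y FFy limE] := limit_set_two_points x.
have [Fy | /eqP neq] := eqVneq (F y) y.
  by left; exists y => // w; rewrite limE Fy; split; [case | left].
by right; exists y, (F y); split=> // /esym.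
Qed.

Lemma has_period_1_or_2 x :
  periodic F x -> has_period F x 1 \/ has_period F x 2.
Proof.
move=> /F2 FFx; have [Fx | /eqP neq] := eqVneq (F x) x; [left | right].
  by split.
by split=> // -[|[|q]].
Qed.

End PeriodAtMostTwo.

Theorem corollary3p4 (n : nat) (e : rel 'I_n)
    (e_sym : symmetric e) (e_irr : irreflexive e)
    (kup kdown : 'I_n -> int) :
  (forall x : state n,
     is_fixed_point (sync_map e kup kdown) (limit_set (sync_map e kup kdown) x)
     \/ is_two_cycle (sync_map e kup kdown) (limit_set (sync_map e kup kdown) x))
  /\
  (forall x : state n, periodic (sync_map e kup kdown) x ->
     has_period (sync_map e kup kdown) x 1
     \/ has_period (sync_map e kup kdown) x 2).
Proof.
have F2 x := @sync_map_periodic n e kup kdown x e_sym.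
by split=> x; [apply: limit_set_fixed_or_two_cycle | apply: has_period_1_or_2].
Qed.
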